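(* Let $M\subseteq 2^{[n]}$ be a matroid (given by its set of bases) of rank $d$ on the ground set $[n]$, and let $P=P(M)=\{\sum_{i\in A}\mathbf e_i\mid A\in M\}\subset\{0,1\}^n$ be the corresponding polymatroid. Then $$\mathscr{T}_P(x,y)=x^{n-d}\,y^{d}\;T_M\!\left(\frac{x+y-1}{y},\frac{x+y-1}{x}\right),$$ where $\mathscr{T}_P$ is the polymatroid Tutte polynomial of $P$ and $T_M$ is the classical Tutte polynomial of $M$.
   Context: Notation: $[n]=\{1,\dots,n\}$; $\mathbf e_1,\dots,\mathbf e_n$ is the canonical basis of $\mathbb{R}^n$. A matroid is identified with its set of bases; the rank is the common cardinality of the bases. Classical Tutte polynomial: for a basis $A\in M$, $i\in A$ is internally active if there is no $j<i$ such that $(A\setminus\{i\})\cup\{j\}$ is a basis; $i\in[n]\setminus A$ is externally active if there is no $j<i$ such that $(A\cup\{i\})\setminus\{j\}$ is a basis. With $\mathrm{Int}_M(A)\subseteq A$ and $\mathrm{Ext}_M(A)\subseteq[n]\setminus A$ the sets of such elements, $T_M(x,y)=\sum_{A\in M}x^{|\mathrm{Int}_M(A)|}y^{|\mathrm{Ext}_M(A)|}$. A polymatroid in $\mathbb{Z}^n$ is a finite nonempty set $P\subset\mathbb{Z}^n$ satisfying the Exchange Axiom: for any $\mathbf a,\mathbf b\in P$ and any $i\in[n]$ with $a_i>b_i$, there exists $j\in[n]$ such that $a_j<b_j$ and both $\mathbf a-\mathbf e_i+\mathbf e_j$ and $\mathbf b+\mathbf e_i-\mathbf e_j$ belong to $P$.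 For $\mathbf a\in P$, an index $i\in[n]$ is internally active if there is no $j<i$ with $\mathbf a-\mathbf e_i+\mathbf e_j\in P$, and externally active if there is no $j<i$ with $\mathbf a+\mathbf e_i-\mathbf e_j\in P$. Let $\mathrm{Int}(\mathbf a),\mathrm{Ext}(\mathbf a)\subseteq[n]$ be the sets of internally, respectively externally, active indices. The polymatroid Tutte polynomial is $$\mathscr{T}_P(x,y)=\sum_{\mathbf a\in P}x^{|\mathrm{Int}(\mathbf a)\setminus\mathrm{Ext}(\mathbf a)|}\,y^{|\mathrm{Ext}(\mathbf a)\setminus\mathrm{Int}(\mathbf a)|}\,(x+y-1)^{|\mathrm{Int}(\mathbf a)\cap\mathrm{Ext}(\mathbf a)|}.$$ *)

(* Defs.v *)
From HB Require Import structures.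
From mathcomp Require Import all_boot all_order all_algebra.
From mathcomp Require Import finmap.
From mathcomp Require Import mpoly.

Set Implicit Arguments.
Unset Strict Implicit.
Unset Printing Implicit Defensive.

Import Order.TTheory GRing.Theory Num.Theory.
Local Open Scope ring_scope.

(* The ground set [n] is 'I_n, i.e. {0, ..., n-1} with its usual order. *)

Record matroid (n : nat) := Matroid {
  bases :> {set {set 'I_n}};
  bases_nonempty : bases != set0;
  bases_exchange : forall A B : {set 'I_n}, A \in bases -> B \in bases ->
    forall i, i \in A :\: B ->
      exists2 j, j \in B :\: A & j |: (A :\ i) \in bases
}.

Definition has_rank n (M : matroid n) (d : nat) : Prop :=
  forall A : {set 'I_n}, A \in bases M -> #|A| = d.

Definition evec n (i : 'I_n) : 'rV[int]_n := delta_mx 0 i.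

Record polymatroid (n : nat) := Polymatroid {
  points :> {fset 'rV[int]_n};
  points_nonempty : points != fset0;
  points_exchange : forall a b : 'rV[int]_n, a \in points -> b \in points ->
    forall i, b 0 i < a 0 i ->
      exists j, [/\ a 0 j < b 0 j,
                    a - evec i + evec j \in points &
                    b + evec i - evec j \in points]
}.

(* Tutte polynomials live in Z[x, y], encoded as {mpoly int[2]}. *)
Definition Xvar : {mpoly int[2]} := 'X_ord0.
Definition Yvar : {mpoly int[2]} := 'X_ord_max.

Definition eval2 (K : comNzRingType) (p : {mpoly int[2]}) (u v : K) : K :=
  mmap intr (tnth [tuple u; v]) p.

Section MatroidTutte.
Variables (n : nat) (M : matroid n).
Implicit Types A : {set 'I_n}.

Definition mat_int A : {set 'I_n} :=
  [set i in A | ~~ [exists j : 'I_n,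
                      (j < i)%N && (j |: (A :\ i) \in bases M)]].

Definition mat_ext A : {set 'I_n} :=
  [set i in ~: A | ~~ [exists j : 'I_n,
                         (j < i)%N && ((i |: A) :\ j \in bases M)]].

Definition tutte : {mpoly int[2]} :=
  \sum_(A in bases M) Xvar ^+ #|mat_int A| * Yvar ^+ #|mat_ext A|.

End MatroidTutte.

Section PolymatroidTutte.
Variables (n : nat) (P : polymatroid n).
Implicit Types a : 'rV[int]_n.

Definition pm_int a : {set 'I_n} :=
  [set i : 'I_n | ~~ [exists j : 'I_n,
                 (j < i)%N && (a - evec i + evec j \in points P)]].

Definition pm_ext a : {set 'I_n} :=
  [set i : 'I_n | ~~ [exists j : 'I_n,
                 (j < i)%N && (a + evec i - evec j \in points P)]].

Definition polymatroid_tutte : {mpoly int[2]} :=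
  \sum_(a <- points P)
     Xvar ^+ #|pm_int a :\: pm_ext a|
   * Yvar ^+ #|pm_ext a :\: pm_int a|
   * (Xvar + Yvar - 1) ^+ #|pm_int a :&: pm_ext a|.

End PolymatroidTutte.

Definition indicator n (A : {set 'I_n}) : 'rV[int]_n := \sum_(i in A) evec i.

Definition indicators n (M : matroid n) : {fset 'rV[int]_n} :=
  [fset indicator A | A in bases M]%fset.

Lemma indicatorE n (A : {set 'I_n}) j : indicator A 0 j = (j \in A)%:R.
Proof.
rewrite /indicator summxE; under eq_bigr do rewrite mxE eqxx /=.
case: (boolP (j \in A)) => jA.
  rewrite (bigD1 j) //= eqxx big1 ?addr0 // => i /andP[_ ij].
  by rewrite eq_sym (negbTE ij).
by rewrite big1 // => i iA; case: eqP jA => // ->; rewrite iA.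
Qed.

Lemma indicator_swap n (A : {set 'I_n}) i j : i \in A -> j \notin A ->
  indicator (j |: (A :\ i)) = indicator A - evec i + evec j.
Proof.
move=> iA jA; apply/rowP => k.
rewrite !mxE !eqxx /= !indicatorE !inE.
case: (eqVneq k j) => [->|kj].
  rewrite (negbTE jA); case: eqP jA => [->|_ _ //]; by rewrite iA.
by case: (eqVneq k i) => [->|ki]; rewrite /= ?iA ?subrr ?subr0 ?addr0.
Qed.

Section SymmetricExchange.
Variables (n : nat) (M : matroid n).
Implicit Types A B D : {set 'I_n}.

Lemma card_swap A i j : i \in A -> j \notin A -> #|j |: (A :\ i)| = #|A|.
Proof.
move=> iA jA; rewrite cardsU1 !inE (negbTE jA) andbF /= [RHS](cardsD1 i).
by rewrite iA.
Qed.

Lemma bases_card A B : A \in bases M -> B \in bases M -> #|A| = #|B|.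
Proof.
move: {2}#|A :\: B| (leqnn #|A :\: B|) => m.
elim: m A => [|m IH] A mAB AM BM.
  have sAB : A \subset B by rewrite -setD_eq0 -cards_eq0 -leqn0.
  congr #|pred_of_set _|; apply/eqP; rewrite eqEsubset sAB /=.
  apply/subsetP => b bB; apply/negPn/negP => bA.
  have bBA : b \in B :\: A by rewrite inE bA.
  have [j] := bases_exchange BM AM bBA.
  by rewrite inE => /andP[/negP jB /(subsetP sAB)].
have [D0|[i iAB]] := set_0Vmem (A :\: B).
  by apply: IH; rewrite // D0 cards0.
have [j] := bases_exchange AM BM iAB.
move: (iAB); rewrite !inE => /andP[iB iA] /andP[jA jB] DM.
rewrite -(card_swap iA jA); apply: IH => //.
rewrite -ltnS; apply: leq_trans mAB; apply: proper_card.
apply/properP; split.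
  apply/subsetP => k; rewrite !inE => /andP[kB].
  by case/orP=> [/eqP kj|/andP[_ ->]]; [rewrite kj jB in kB | rewrite kB].
exists i => //; rewrite !inE eqxx orbF iB /=.
by apply: contraNneq jA => <-.
Qed.

Lemma matroid_has_rank : exists d, has_rank M d.
Proof.
have /set0Pn[A AM] := bases_nonempty M.
by exists #|A| => B BM; exact: bases_card.
Qed.

Lemma bases_sym_exchange A B : A \in bases M -> B \in bases M ->
  forall i, i \in A :\: B ->
  exists j, [/\ j \in B :\: A, j |: (A :\ i) \in bases M
               & i |: (B :\ j) \in bases M].
Proof.
move=> AM BM i; rewrite inE => /andP[iB iA].
pose J := [set j in B | i |: (B :\ j) \in bases M].
have JB : J \subset B by apply/subsetP => j; rewrite inE => /andP[].
have noJi D : D \in bases M -> J \subset D -> i \notin D.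
  move=> DM0 JD0; apply/negP => iD0.
  pose Q D := [&& D \in bases M, J \subset D & i \in D].
  have QD : Q D by apply/and3P.
  case: (arg_maxnP (fun D => #|D :&: B|) QD) => {DM0 JD0 iD0 QD} {}D.
  case/and3P=> DM JD iD Dmax.
  have DB k : k \in D -> k \notin B -> k = i.
    move=> kD kB; apply/eqP/negPn/negP => ki.
    have kDB : k \in D :\: B by rewrite inE kB.
    have [l] := bases_exchange DM BM kDB.
    rewrite inE => /andP[lD lB] EM.
    have := Dmax (l |: (D :\ k)); rewrite /Q EM !inE iD eq_sym (eq_sym i k) ki /= orbT andbT.
    have JE : J \subset l |: (D :\ k).
      apply/subsetP => m mJ; rewrite !inE (subsetP JD _ mJ) andbT.
      apply/orP; right; apply: contraNneq kB => <-.
      exact: (subsetP JB).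
    move=> /(_ JE); rewrite leqNgt => /negP; apply.
    apply: proper_card; apply/properP; split.
      apply/subsetP => m; rewrite !inE => /andP[mD mB]; rewrite mD mB !andbT.
      by apply/orP; right; apply: contraNneq kB => <-.
    by exists l; rewrite !inE ?eqxx ?lB // (negbTE lD).
  have iDB : i \in D :\: B by rewrite inE iB.
  have [j] := bases_exchange DM BM iDB.
  rewrite inE => /andP[jD jB] EM.
  have DE : D = i |: (B :\ j).
    apply/eqP; rewrite eqEcard (bases_card DM BM) card_swap // leqnn andbT.
    apply/subsetP => k kD; rewrite !inE.
    case: (boolP (k \in B)) => kB; last by rewrite (DB k) ?eqxx.
    by rewrite andbT; apply/orP; right; apply: contraNneq jD => <-.
  have : j \in J by rewrite inE jB -DE.
  by move/(subsetP JD); rewrite (negbTE jD).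
pose Q D := (D \in bases M) && (J \subset D).
have QB : Q B by apply/andP.
case: (arg_maxnP (fun D => #|D :&: A|) QB) => D /andP[DM JD] Dmax.
have DJ k : k \in D -> k \notin A -> k \in J.
  move=> kD kA; apply/negPn/negP => kJ.
  have kDA : k \in D :\: A by rewrite inE kA.
  have [l] := bases_exchange DM AM kDA.
  rewrite inE => /andP[lD lA] EM.
  have := Dmax (l |: (D :\ k)); rewrite /Q EM /=.
  have JE : J \subset l |: (D :\ k).
    apply/subsetP => m mJ; rewrite !inE (subsetP JD _ mJ) andbT.
    by apply/orP; right; apply: contraNneq kJ => <-.
  move=> /(_ JE); rewrite leqNgt => /negP; apply.
  apply: proper_card; apply/properP; split.
    apply/subsetP => m; rewrite !inE => /andP[mD mA]; rewrite mD mA !andbT.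
    by apply/orP; right; apply: contraNneq kA => <-.
  by exists l; rewrite !inE ?eqxx ?lA // (negbTE lD).
have iAD : i \in A :\: D by rewrite inE iA noJi.
have [j] := bases_exchange AM DM iAD.
rewrite inE => /andP[jA jD] EM.
have := DJ j jD jA; rewrite inE => /andP[jB FM].
by exists j; rewrite inE jA jB.
Qed.

Lemma indicators_nonempty : indicators M != fset0.
Proof.
have /set0Pn[A AM] := bases_nonempty M.
by apply/fset0Pn; exists (indicator A); apply: in_imfset.
Qed.

Lemma indicators_exchange (a b : 'rV[int]_n) :
  a \in indicators M -> b \in indicators M ->
  forall i, b 0 i < a 0 i ->
    exists j, [/\ a 0 j < b 0 j,
                  a - evec i + evec j \in indicators M &
                  b + evec i - evec j \in indicators M].
Proof.
move=> /imfsetP[A /= AM ->] /imfsetP[B /= BM ->] i.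
rewrite !indicatorE => lt_ba.
have [iA iB] : i \in A /\ i \notin B by move: lt_ba; do 2 case: (_ \in _).
have iAB : i \in A :\: B by rewrite inE iB.
have [j [+ EM FM]] := bases_sym_exchange AM BM iAB.
rewrite inE => /andP[jA jB]; exists j; split.
- by rewrite !indicatorE jB (negbTE jA).
- by rewrite -indicator_swap //; apply: in_imfset.
- by rewrite addrAC -indicator_swap //; apply: in_imfset.
Qed.

End SymmetricExchange.

Definition matroid_polymatroid n (M : matroid n) : polymatroid n :=
  Polymatroid (indicators_nonempty M) (@indicators_exchange n M).

(* Main.v *)
Require Import Defs.
From mathcomp Require Import all_boot all_order all_algebra.
From mathcomp Require Import finmap mpoly.

Set Implicit Arguments.
Unset Strict Implicit.
Unset Printing Implicit Defensive.

Import GRing.Theory.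
Local Open Scope ring_scope.

(** Fix a basis [A] and write [a] for its indicator vector.  The points of the
polymatroid have all their coordinates in {0, 1}, so a step [a - e_i + e_j]
with [j != i] can only stay in the polymatroid when [i] lies in [A] and [j]
does not, and then it is the basis exchange replacing [i] by [j].  Two
consequences describe the polymatroid activities of [a]:
- every [i] outside [A] is internally active for [a], and inside [A] the two
  notions of internal activity agree, so that [Int a = ~A U Int_M A];
- symmetrically, [Ext a = A U Ext_M A].
Hence [Int a :\: Ext a] is [~A] deprived of [Ext_M A], [Ext a :\: Int a] is [A]
deprived of [Int_M A], and [Int a :&: Ext a] is the disjoint union of [Int_M A]
and [Ext_M A].  With [p = #|Int_M A|] and [q = #|Ext_M A|], the term of [a] in
the polymatroid Tutte polynomial is therefore
  [x ^ (n - d - q) * y ^ (d - p) * (x + y - 1) ^ (p + q)],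
which is [x ^ (n - d) * y ^ d] times the value of the monomial [x ^ p * y ^ q]
at [((x + y - 1) / y, (x + y - 1) / x)].  Summing over the bases gives the
theorem (activities: [pm_int_indicator], [pm_ext_indicator]). *)

Lemma indicator_inj n : injective (@indicator n).
Proof.
move=> A B eqAB; apply/setP => i; have := congr1 (fun v : 'rV[int]_n => v 0 i) eqAB.
by rewrite !indicatorE; do 2 case: (_ \in _).
Qed.

Lemma indicator_bases n (M : matroid n) A :
  (indicator A \in indicators M) = (A \in bases M).
Proof.
apply/idP/idP => [/imfsetP[B /= BM /indicator_inj-> //] | AM].
exact: in_imfset.
Qed.

(** A step that removes a unit where there is none, or adds one where there is
already one, produces a coordinate -1 or 2. *)
Lemma step_notin_indicators n (M : matroid n) (A : {set 'I_n}) i j :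
    i != j -> (i \notin A) || (j \in A) ->
  indicator A - evec i + evec j \notin indicators M.
Proof.
move=> ij iAjA; apply/negP => /imfsetP[B /= _ eqB].
have coord k := congr1 (fun v : 'rV[int]_n => v 0 k) eqB.
case/orP: iAjA => [/negbTE iA | jA].
  have := coord i; rewrite /= !mxE !indicatorE iA !eqxx (negbTE ij) /=.
  by case: (_ \in _).
have := coord j; rewrite /= !mxE !indicatorE jA !eqxx eq_sym (negbTE ij) /=.
by case: (_ \in _).
Qed.

(** The hypothesis on [i] and [j] excludes only the case where [i] is outside
[A] and [j] inside it, in which [j |: (A :\ i)] is [A] itself and is a basis
although the step leaves the polymatroid.  When [i] and [j] are both in [A] or
both outside, the modified set has the wrong cardinality to be a basis. *)
Lemma step_bases n (M : matroid n) (A : {set 'I_n}) i j :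
    A \in bases M -> i != j -> (i \in A) || (j \notin A) ->
  (indicator A - evec i + evec j \in indicators M)
    = (j |: (A :\ i) \in bases M).
Proof.
move=> AM ij iAjA.
have [/andP[iA jA] | ] := boolP ((i \in A) && (j \notin A)).
  by rewrite -indicator_swap // indicator_bases.
rewrite negb_and negbK => badij.
rewrite (negbTE (step_notin_indicators M ij badij)); apply/esym/negP => BM.
have := bases_card BM AM; rewrite cardsU1 !inE eq_sym ij /= (cardsD1 i A).
case: (i \in A) iAjA badij => /= [_ -> | /negbTE-> _] /=.
  by move/eqP; rewrite ltn_eqF.
by move/eqP; rewrite gtn_eqF.
Qed.

Lemma pm_int_indicator n (M : matroid n) (A : {set 'I_n}) :
  A \in bases M ->
  pm_int (matroid_polymatroid M) (indicator A) = ~: A :|: mat_int M A.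
Proof.
move=> AM; apply/setP => i; rewrite !inE.
have [iA | iA] /= := boolP (i \in A); last first.
  apply/existsPn => j; rewrite negb_and -implybE; apply/implyP => ltji.
  by rewrite step_notin_indicators ?iA // neq_ltn ltji orbT.
congr (~~ _); apply: eq_existsb => j /=; apply: andb_id2l => ltji.
by rewrite step_bases ?iA // neq_ltn ltji orbT.
Qed.

Lemma pm_ext_indicator n (M : matroid n) (A : {set 'I_n}) :
  A \in bases M ->
  pm_ext (matroid_polymatroid M) (indicator A) = A :|: mat_ext M A.
Proof.
move=> AM; apply/setP => i; rewrite !inE.
have [iA | iA] /= := boolP (i \in A).
  apply/existsPn => j; rewrite negb_and -implybE; apply/implyP => ltji.
  by rewrite addrAC step_notin_indicators ?iA ?orbT // neq_ltn ltji.
congr (~~ _); apply: eq_existsb => j /=; apply: andb_id2l => ltji.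
have neji : j != i by rewrite neq_ltn ltji.
have -> : (i |: A) :\ j = i |: (A :\ j).
  apply/setP => k; rewrite !inE.
  by case: (eqVneq k i) => // ->; rewrite eq_sym neji.
by rewrite addrAC step_bases ?iA ?orbT.
Qed.

Lemma mat_int_sub n (M : matroid n) A : mat_int M A \subset A.
Proof. by apply/subsetP => i; rewrite inE => /andP[]. Qed.

Lemma mat_ext_sub n (M : matroid n) A : mat_ext M A \subset ~: A.
Proof. by apply/subsetP => i; rewrite inE => /andP[]. Qed.

(** [I] and [E] stand for the internally and externally active elements of a
basis [A]; the three sets are those counted by the exponents of the polymatroid
Tutte polynomial. *)
Lemma card_activities (T : finType) (A I E : {set T}) :
    I \subset A -> E \subset ~: A ->
  [/\ #|(~: A :|: I) :\: (A :|: E)| = (#|T| - #|A| - #|E|)%N,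
      #|(A :|: E) :\: (~: A :|: I)| = (#|A| - #|I|)%N
    & #|(~: A :|: I) :&: (A :|: E)| = (#|I| + #|E|)%N].
Proof.
move=> sIA sEA.
have IA i : (i \in I) ==> (i \in A) by apply/implyP/subsetP.
have EA i : (i \in E) ==> (i \notin A).
  by apply/implyP => /(subsetP sEA); rewrite inE.
have IE0 : I :&: E = set0.
  apply/setP => i; move: (IA i) (EA i); rewrite !inE.
  by do 3 case: (i \in _).
have cardCA : (#|T| - #|A|)%N = #|~: A| by rewrite [RHS]cardsCs setCK.
split.
- rewrite cardCA -[in RHS](setIidPr sEA) -cardsD; apply: eq_card => i.
  by move: (IA i) (EA i); rewrite !inE; do 3 case: (i \in _).
- rewrite -[in RHS](setIidPr sIA) -cardsD; apply: eq_card => i.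
  by move: (IA i) (EA i); rewrite !inE; do 3 case: (i \in _).
rewrite -cardsUI IE0 cards0 addn0; apply: eq_card => i.
by move: (IA i) (EA i); rewrite !inE; do 3 case: (i \in _).
Qed.

Lemma polymatroid_tutte_bases n d (M : matroid n) : has_rank M d ->
  polymatroid_tutte (matroid_polymatroid M)
  = \sum_(A in bases M)
       Xvar ^+ (n - d - #|mat_ext M A|) * Yvar ^+ (d - #|mat_int M A|)
       * (Xvar + Yvar - 1) ^+ (#|mat_int M A| + #|mat_ext M A|).
Proof.
move=> Md; rewrite /polymatroid_tutte /= /indicators.
rewrite big_imfset /=; last by move=> A B _ _; exact: indicator_inj.
rewrite big_enum; apply: eq_bigr => A AM.
rewrite pm_int_indicator // pm_ext_indicator //.
have [-> -> ->] := card_activities (mat_int_sub M A) (mat_ext_sub M A).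
by rewrite card_ord (Md A AM).
Qed.

Lemma eval2_tutte n (M : matroid n) (K : comNzRingType) (u v : K) :
  eval2 (tutte M) u v
  = \sum_(A in bases M) u ^+ #|mat_int M A| * v ^+ #|mat_ext M A|.
Proof.
rewrite /eval2 /tutte raddf_sum /=; apply: eq_bigr => A _.
by rewrite rmorphM !rmorphXn /= !mmapX !mmap1U.
Qed.

Lemma monomial_subst (F : fieldType) (x y z : F) k d p q :
    x != 0 -> y != 0 -> (q <= k)%N -> (p <= d)%N ->
  x ^+ (k - q) * y ^+ (d - p) * z ^+ (p + q)
  = x ^+ k * y ^+ d * ((z / y) ^+ p * (z / x) ^+ q).
Proof.
move=> x0 y0 leqk lepd.
rewrite !expfB_cond ?(negbTE x0) ?(negbTE y0) // exprD !expr_div_n.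
rewrite [_ / _ * (_ / _)]mulrACA -[LHS]mulrA; congr (_ * _).
by rewrite [RHS]mulrACA mulrC [_^-1 * _]mulrC.
Qed.

Theorem theorem5p2 (n d : nat) (M : matroid n) (hd : has_rank M d) :
  let x : {fraction {mpoly int[2]}} := tofrac Xvar in
  let y : {fraction {mpoly int[2]}} := tofrac Yvar in
  tofrac (polymatroid_tutte (matroid_polymatroid M))
  = x ^+ (n - d) * y ^+ d
    * eval2 (tutte M) ((x + y - 1) / y) ((x + y - 1) / x).
Proof.
move=> x y.
have x0 : x != 0 by rewrite tofrac_eq0 -msupp_eq0 msuppX.
have y0 : y != 0 by rewrite tofrac_eq0 -msupp_eq0 msuppX.
rewrite (polymatroid_tutte_bases hd) eval2_tutte rmorph_sum big_distrr /=.
apply: eq_bigr => A AM.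
rewrite !rmorphM !rmorphXn rmorphB rmorphD rmorph1 /= -/x -/y.
have cardCA : (n - d)%N = #|~: A|.
  by rewrite [RHS]cardsCs setCK card_ord (hd A AM).
apply: monomial_subst => //.
  by rewrite cardCA subset_leq_card ?mat_ext_sub.
by rewrite -(hd A AM) subset_leq_card ?mat_int_sub.
Qed.
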